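(* For all integers $n,\gamma\in\mathbb{N}$ and $0\le d\le n$, every choice of nodes $a=x_0<x_1<\dots<x_n=b$ and every $f:[a,b]\to\mathbb{R}$, the generalized Floater--Hormann rational function $\tilde r(x)$ has no real poles.
   Context: $\mathbb{N}=\{1,2,3,\ldots\}$. Given nodes $a=x_0<x_1<\dots<x_n=b$, a function $f:[a,b]\to\mathbb{R}$, an integer $0\le d\le n$ and $\gamma\in\mathbb{N}$, for $i=0,\ldots,n-d$ let $p_i$ be the unique polynomial of degree $\le d$ interpolating $f$ at $x_i,x_{i+1},\ldots,x_{i+d}$, and let $$\tilde\lambda_i(x)=\frac{(-1)^{i\gamma}}{(x-x_i)^\gamma(x-x_{i+1})^\gamma\cdots(x-x_{i+d})^\gamma}.$$ The generalized Floater--Hormann interpolant of $f$ is the rational function $$\tilde r(x)=\frac{\sum_{i=0}^{n-d}\tilde\lambda_i(x)p_i(x)}{\sum_{i=0}^{n-d}\tilde\lambda_i(x)}.$$ Multiplying numerator and denominator by $(-1)^{\gamma(n-d)}\prod_{k=0}^n(x-x_k)^\gamma$, it is written as a quotient of two polynomials $$\tilde r(x)=\frac{P(x)}{Q(x)}=\frac{\sum_{i=0}^{n-d}\tilde\mu_i(x)p_i(x)}{\sum_{i=0}^{n-d}\tilde\mu_i(x)},\qquad \tilde\mu_i(x)=\prod_{k=0}^{i-1}(x-x_k)^\gamma\prod_{k=i+d+1}^n(x_k-x)^\gamma,$$ with empty products equal to $1$. *)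

(* Defs.v *)
From HB Require Import structures.
From mathcomp Require Import all_boot all_order all_algebra.
From mathcomp Require Import reals.

Set Implicit Arguments.
Unset Strict Implicit.
Unset Printing Implicit Defensive.

Import Order.TTheory GRing.Theory Num.Theory.
Local Open Scope ring_scope.

Section Pole.
Variable F : fieldType.

(* A pole is a zero of the denominator of the fraction in lowest terms.  The
   condition [q != 0] is needed because [p%:F / 0 = 0] in [{fraction _}]. *)
Definition pole (r : {fraction {poly F}}) (c : F) : Prop :=
  exists p q : {poly F},
    [/\ q != 0, coprimep p q, r = tofrac p / tofrac q & root q c].

End Pole.

Section FloaterHormann.
Variables (R : realType) (n : nat) (x : 'I_n.+1 -> R).

(* Only the values of [f] at the nodes matter, so a function on [a, b] is
   represented by any of its extensions to [R]. *)
Definition interpolates (f : R -> R) (d i : nat) (p : {poly R}) : Prop :=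
  (size p <= d.+1)%N /\
  forall k : 'I_n.+1, (i <= k <= i + d)%N -> p.[x k] = f (x k).

Definition fh_weight (d gamma i : nat) : {fraction {poly R}} :=
  (-1) ^+ (i * gamma) /
  \prod_(k < n.+1 | (i <= k <= i + d)%N) tofrac ('X - (x k)%:P) ^+ gamma.

Definition fh_denominator (d gamma : nat) : {fraction {poly R}} :=
  \sum_(i < (n - d).+1) fh_weight d gamma i.

Definition fh_rational (d gamma : nat) (p : 'I_(n - d).+1 -> {poly R}) :
    {fraction {poly R}} :=
  (\sum_(i < (n - d).+1) fh_weight d gamma i * tofrac (p i)) /
  fh_denominator d gamma.

Lemma card_window (d i : nat) :
  (i + d <= n)%N -> #|[pred k : 'I_n.+1 | (i <= k <= i + d)%N]| = d.+1.
Proof.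
move=> le_n.
have lt_n (j : 'I_d.+1) : (i + j < n.+1)%N.
  by rewrite ltnS (leq_trans _ le_n) // leq_add2l -ltnS.
pose g (j : 'I_d.+1) : 'I_n.+1 := Ordinal (lt_n j).
have g_inj : injective g by move=> j k [/addnI e]; apply: val_inj.
rewrite -[RHS](card_ord d.+1) -(card_codom g_inj).
apply: eq_card => k; rewrite !inE; apply/idP/codomP => [/andP[ik kd]|[j ->]].
  have kid : (k - i < d.+1)%N by rewrite ltnS leq_subLR.
  by exists (Ordinal kid); apply: val_inj; rewrite /= subnKC.
by rewrite /= leq_addr leq_add2l -ltnS ltn_ord.
Qed.

Lemma interpolates_exists_unique (f : R -> R) (d i : nat) :
  injective x -> (i + d <= n)%N -> exists! p, interpolates f d i p.
Proof.
move=> x_inj le_n; pose S := [pred k : 'I_n.+1 | (i <= k <= i + d)%N].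
have cardS : #|S| = d.+1 by apply: card_window.
pose L k := \prod_(j in [predD1 S & k]) ((x k - x j)^-1 *: ('X - (x j)%:P)).
have sizeL k : k \in S -> (size (L k) <= d.+1)%N.
  move=> Sk; apply: leq_trans (size_poly_prod_leq _ _) _.
  have cardSk : #|[predD1 S & k]| = d.
    by move: cardS; rewrite (cardD1 k) Sk => -[].
  rewrite cardSk leq_subLR addnS ltnS addnn -muln2 -{1}cardSk -sum_nat_const.
  apply: leq_sum => j _.
  by apply: leq_trans (size_scale_leq _ _) _; rewrite size_XsubC.
have [p [size_p fp]] : exists p, interpolates f d i p.
  exists (\sum_(k in S) f (x k) *: L k); split=> [|k Sk].
    apply: leq_trans (size_sum _ _ _) _; apply/bigmax_leqP => k Sk.
    exact: leq_trans (size_scale_leq _ _) (sizeL k Sk).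
  rewrite horner_sum (bigD1 k) //= hornerZ /L horner_prod.
  rewrite big1 => [|j /andP[jk _]]; last first.
    by rewrite !hornerE mulVf // subr_eq0 (inj_eq x_inj) eq_sym.
  rewrite mulr1 big1 ?addr0 // => j /andP[_ jk].
  rewrite hornerZ horner_prod (bigD1 k) ?inE /= 1?eq_sym ?jk //=.
  by rewrite hornerZ hornerXsubC subrr mulr0 mul0r mulr0.
exists p; split=> // q [size_q fq]; apply/eqP; rewrite -subr_eq0; apply/eqP.
apply: (@roots_geq_poly_eq0 _ _ [seq x k | k in S]).
- apply/allP => _ /imageP[k Sk ->].
  by rewrite /root hornerD hornerN fp // fq // subrr.
- by rewrite map_inj_uniq // enum_uniq.
- rewrite size_map -cardE cardS; apply: leq_trans (size_polyD _ _) _.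
  by rewrite size_polyN geq_max size_p.
Qed.

End FloaterHormann.

(* Main.v *)
(** After multiplying by [(-1)^(gamma (n-d)) \prod_k ('X - x_k)^gamma] the
    denominator becomes [Q = \sum_i mu_i], and [Q] is positive at every real
    [c].  If [c] is a node, each [mu_i(c)] is nonnegative and those whose window
    contains [c] are positive.  Otherwise let [s] be the number of nodes below
    [c].  For [s - d <= i < s] the term [mu_i(c)] is positive; read away from
    this range in either direction the terms have decreasing absolute value,
    alternate in sign if [gamma] is odd, and start with a positive one.  So
    grouping them in consecutive pairs shows that both tails are positive.
    Finally a zero of a reduced denominator of [P / Q] which is not a zero of
    [Q] would also be a zero of the reduced numerator. *)
Require Import Defs.
From mathcomp Require Import all_boot all_order all_algebra.
From mathcomp Require Import reals.
From mathcomp Require Import zify ring lra.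

Set Implicit Arguments.
Unset Strict Implicit.
Unset Printing Implicit Defensive.

Import Order.TTheory GRing.Theory Num.Theory.
Local Open Scope ring_scope.

(** * Positivity of sums by grouping terms in pairs *)

Lemma sumr_pairs_gt0 (R : numDomainType) (m : nat) (f : nat -> R) :
  (0 < m)%N ->
  (forall j, (j.*2 < m)%N -> 0 < f j.*2) ->
  (forall j, (j.*2.+1 < m)%N -> 0 < f j.*2 + f j.*2.+1) ->
  0 < \sum_(0 <= j < m) f j.
Proof.
(* Two terms are removed at a time, so a term left alone at the end has even index. *)
elim/ltn_ind: m f => -[//|[|m]] IH f _ f_even f_pair.
  by rewrite big_nat1; exact: (f_even 0%N).
rewrite big_nat_recl // big_nat_recl // addrA.
case: m => [|m] in IH f_even f_pair *.
  by rewrite big_geq // addr0; exact: (f_pair 0%N).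
apply: addr_gt0; first exact: (f_pair 0%N).
apply: (IH m.+1 _ (fun j => f j.+2)) => // j lt_jm.
  exact: (f_even j.+1).
exact: (f_pair j.+1).
Qed.

(** Two consecutive terms have the common factor [A j * B j.+1], with cofactor [w j + z j]. For even
    [j], [A j] is positive because it is [A 0] times products of the form [w i * w i.+1]. *)
Lemma sumr_tail_gt0 (R : numDomainType) (m : nat) (A B w z : nat -> R) :
  (0 < m)%N -> 0 < A 0%N ->
  (forall j, (j < m)%N -> 0 < B j) ->
  (forall j, (j.+1 < m)%N -> A j.+1 = A j * w j) ->
  (forall j, (j.+1 < m)%N -> B j = B j.+1 * z j) ->
  (forall j, (j.+2 < m)%N -> 0 < w j * w j.+1) ->
  (forall j, (j.+1 < m)%N -> 0 < w j + z j) ->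
  0 < \sum_(0 <= j < m) A j * B j.
Proof.
move=> m_gt0 A0 B_gt0 AS BS ww wz.
have A_even j : (j.*2 < m)%N -> 0 < A j.*2.
  elim: j => // j IH; rewrite doubleS => lt_m.
  rewrite AS // AS ?(ltnW lt_m) // -mulrA mulr_gt0 ?ww //.
  by apply: IH; lia.
apply: sumr_pairs_gt0 => // j lt_m.
  by rewrite mulr_gt0 ?A_even ?B_gt0.
have -> : A j.*2 * B j.*2 + A j.*2.+1 * B j.*2.+1 =
          A j.*2 * B j.*2.+1 * (w j.*2 + z j.*2).
  by rewrite AS // BS //; ring.
by rewrite !mulr_gt0 ?A_even ?B_gt0 ?wz //; lia.
Qed.

(** Since [|y| < z], the power of [z] dominates whatever the parity of [g]. *)
Lemma addr_exp_gt0 (R : realDomainType) (g : nat) (y z : R) :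
  (0 < g)%N -> y < 0 -> - y < z -> 0 < y ^+ g + z ^+ g.
Proof.
move=> g_gt0 y_lt0 yz; have z_gt0 : 0 < z by lra.
suff: `|y ^+ g| < z ^+ g by rewrite ltr_norml; lra.
by rewrite normrX ltr0_norm // ltrXn2r ?nnegrE; lra || lia.
Qed.

(** * Positivity of the denominator at a fixed point *)

Section WeightSum.
Variables (R : realDomainType) (n d g : nat) (u : nat -> R).
Hypotheses (g_gt0 : (0 < g)%N) (le_dn : (d <= n)%N).
Hypothesis u_decr : forall i j, (i < j <= n)%N -> u j < u i.

(** For [u k = c - x_k], [A i] and [B i] are the factors of [mu_i(c)] coming from the nodes before
    and after the window of [i]. *)
Let A i := \prod_(0 <= k < i) u k ^+ g.
Let B i := \prod_((i + d).+1 <= k < n.+1) (- u k) ^+ g.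

Let AS i : A i.+1 = A i * u i ^+ g.
Proof. by rewrite /A big_nat_recr. Qed.

Let BS i : (i + d < n)%N -> B i = B i.+1 * (- u (i + d).+1) ^+ g.
Proof. by move=> lt_n; rewrite /B big_ltn 1?mulrC. Qed.

Let A_gt0 i : (forall k, (k < i)%N -> 0 < u k) -> 0 < A i.
Proof.
move=> u_gt0; rewrite /A big_nat; apply: prodr_gt0 => k ?.
by rewrite exprn_gt0 ?u_gt0.
Qed.

Let B_gt0 i : (forall k, (i + d < k <= n)%N -> u k < 0) -> 0 < B i.
Proof.
move=> u_lt0; rewrite /B big_nat; apply: prodr_gt0 => k ?.
by rewrite exprn_gt0 // oppr_gt0 u_lt0.
Qed.

Lemma weight_sum_gt0_zero k0 : (k0 <= n)%N -> u k0 = 0 ->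
  0 < \sum_(0 <= i < (n - d).+1) A i * B i.
Proof.
move=> k0n uk0.
have term_gt0 i : (i <= k0 <= i + d)%N -> 0 < A i * B i.
  move=> ik0; apply: mulr_gt0; [apply: A_gt0 | apply: B_gt0] => k ?;
    by rewrite -uk0; apply: u_decr; lia.
have term_ge0 i : 0 <= A i * B i.
  case: (ltnP k0 i) => [k0i|ik0].
    rewrite /A (bigD1_seq k0) ?iota_uniq ?mem_index_iota //=.
    by rewrite uk0 expr0n gtn_eqF // !mul0r.
  case: (ltnP (i + d) k0) => [idk0|k0id]; last by apply/ltW/term_gt0; lia.
  rewrite [B i](bigD1_seq k0) ?iota_uniq ?mem_index_iota //=.
    by rewrite uk0 oppr0 expr0n gtn_eqF // mul0r mulr0.
  by lia.
(* [minn k0 (n - d)] is an admissible index whose window contains [k0]. *)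
rewrite (bigD1_seq (minn k0 (n - d))) ?iota_uniq ?mem_index_iota //=; last by lia.
by rewrite ltr_pwDl ?sumr_ge0 // term_gt0 //; lia.
Qed.

Section NonNode.
Variable s : nat.
Hypothesis le_sn : (s <= n.+1)%N.
Hypothesis u_gt0 : forall k, (k < s)%N -> 0 < u k.
Hypothesis u_lt0 : forall k, (s <= k <= n)%N -> u k < 0.

Let upper_gt0 : (s < (n - d).+1)%N ->
  0 < \sum_(s <= i < (n - d).+1) A i * B i.
Proof.
move=> lt_s; rewrite -{1}[s]add0n big_addn.
under eq_bigr do rewrite addnC.
(* From one term to the next, [A] gains the factor at [s + j] and [B] loses the one at
   [s + j + d + 1]. Both values of [u] are negative, and the second is larger in absolute value. *)
apply: (@sumr_tail_gt0 _ _ (fun j => A (s + j)) (fun j => B (s + j))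
  (fun j => u (s + j)%N ^+ g) (fun j => (- u (s + j + d).+1) ^+ g)).
- by lia.
- by apply: A_gt0 => k; rewrite addn0; exact: u_gt0.
- by move=> j lt_j; apply: B_gt0 => k ?; apply: u_lt0; lia.
- by move=> j _; rewrite addnS AS.
- by move=> j lt_j; rewrite addnS BS //; lia.
- move=> j lt_j; rewrite -exprMn exprn_gt0 // nmulr_lgt0; apply: u_lt0; lia.
- move=> j lt_j; apply: addr_exp_gt0 => //; first by apply: u_lt0; lia.
  by rewrite ltrN2 u_decr //; lia.
Qed.

Let lower_gt0 : (d < s)%N -> 0 < \sum_(0 <= i < s - d) A i * B i.
Proof.
(* Reversing the sum and exchanging [A] with [B] gives the same pairing, now starting at
   [i = s - d - 1]. *)
move=> lt_s; rewrite big_nat_rev /= add0n.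
under eq_bigr do rewrite mulrC.
apply: (@sumr_tail_gt0 _ _ (fun j => B (s - d - j.+1)) (fun j => A (s - d - j.+1))
  (fun j => (- u (s - d - j.+1 + d)%N) ^+ g) (fun j => u (s - d - j.+2)%N ^+ g)).
- by lia.
- by apply: B_gt0 => k ?; apply: u_lt0; lia.
- by move=> j lt_j; apply: A_gt0 => k ?; apply: u_gt0; lia.
- move=> j lt_j; rewrite BS -?addSn; last by lia.
  by have -> : (s - d - j.+2).+1 = (s - d - j.+1)%N by lia.
- by move=> j lt_j; rewrite -AS; congr A; lia.
- move=> j lt_j; rewrite -exprMn exprn_gt0 // mulrNN mulr_gt0 // u_gt0 //; lia.
- move=> j lt_j; apply: addr_exp_gt0 => //.
    by rewrite oppr_lt0 u_gt0 //; lia.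
  by rewrite opprK u_decr //; lia.
Qed.

Let middle_gt0 i : (s - d <= i < s)%N -> 0 < A i * B i.
Proof.
move=> si; apply: mulr_gt0; [apply: A_gt0 | apply: B_gt0] => k ?;
  [apply: u_gt0 | apply: u_lt0]; lia.
Qed.

Lemma weight_sum_gt0_nonzero : 0 < \sum_(0 <= i < (n - d).+1) A i * B i.
Proof.
(* [t] cuts the middle block off at [N], since [s] can exceed [N]. *)
pose N := (n - d).+1; pose t := minn s N.
have -> : \sum_(0 <= i < N) A i * B i =
    \sum_(0 <= i < s - d) A i * B i + \sum_(s - d <= i < t) A i * B i +
    \sum_(t <= i < N) A i * B i.
  have le_sdt : (s - d <= t)%N by rewrite /t /N; lia.
  by rewrite -[in RHS]big_cat_nat // -[in RHS]big_cat_nat // geq_minr.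
have lower_ge0 : 0 <= \sum_(0 <= i < s - d) A i * B i.
  by case: (ltnP d s) => ?; [apply/ltW/lower_gt0 | rewrite big_geq //; lia].
have mid_ge0 : 0 <= \sum_(s - d <= i < t) A i * B i.
  by rewrite big_nat sumr_ge0 // => i it; apply/ltW/middle_gt0; move: it; rewrite /t; lia.
have upper_ge0 : 0 <= \sum_(t <= i < N) A i * B i.
  rewrite /t; case: (ltnP s N) => sN; last by rewrite big_geq.
  exact/ltW/upper_gt0.
(* A nonempty block is the upper one if [s < N], otherwise the lower one if [d < s], otherwise the
   middle one, which then contains [i = 0]. *)
case: (ltnP s N) => [sN|Ns].
  by rewrite ltr_wpDl ?addr_ge0 // /t (minn_idPl (ltnW sN)) upper_gt0.
case: (ltnP d s) => [ds|sd]; first by rewrite ltr_pwDl // ltr_pwDl // lower_gt0.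
rewrite ltr_pwDl // ltr_wpDl // big_ltn; last by rewrite /t /N; lia.
rewrite ltr_pwDl ?middle_gt0 //; first by rewrite /N in Ns; lia.
rewrite big_nat sumr_ge0 // => i it; apply/ltW/middle_gt0; move: it; rewrite /t; lia.
Qed.

End NonNode.

Lemma weight_sum_gt0 : 0 < \sum_(0 <= i < (n - d).+1) A i * B i.
Proof.
case: (boolP (has (fun k => u k == 0) (iota 0 n.+1))) => [|/hasPn u_neq0].
  by case/hasP => k; rewrite mem_iota => kn /eqP; apply: weight_sum_gt0_zero; lia.
(* The first disjunct yields [s = n + 1] when no [u k] with [k <= n] is negative. *)
pose P k := (n < k)%N || (u k < 0).
have exP : exists k, P k by exists n.+1; rewrite /P ltnSn.
case: (ex_minnP exP) => s Ps s_min.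
have le_sn : (s <= n.+1)%N by apply: s_min; rewrite /P ltnSn.
apply: (@weight_sum_gt0_nonzero s) => // k.
  move=> ks; have : ~~ P k by apply/negP => /s_min; lia.
  rewrite negb_or -leqNgt -leNgt => /andP[kn uk].
  by rewrite lt_def uk u_neq0 // mem_iota; lia.
move=> /andP[sk kn]; case/orP: Ps => [|us]; first by lia.
case: (ltngtP s k) sk => // [sk _|<- //].
by apply: lt_trans us; apply: u_decr; rewrite sk.
Qed.

End WeightSum.

(** * Poles and unreduced denominators *)

Lemma pole_root_denominator (F : fieldType) (p q : {poly F}) (c : F) :
  q != 0 -> pole (tofrac p / tofrac q) c -> root q c.
Proof.
move=> q0 [p' [q' [q'0 cop eq_r root_q']]].
have eq_pq : p * q' = p' * q.
  apply/eqP; rewrite -tofrac_eq !tofracM -eqr_div ?tofrac_eq0 //.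
  exact/eqP.
have : root (p' * q) c by rewrite -eq_pq rootM root_q' orbT.
rewrite rootM => /orP[root_p'|//].
by have := coprimep_root cop root_p'; rewrite -rootE root_q'.
Qed.

(** * From the rational weights to the polynomials [mu_i] *)

Section Denominator.
Variables (R : realType) (n d gamma : nat) (x : 'I_n.+1 -> R).
Hypotheses (gamma_gt0 : (0 < gamma)%N) (le_dn : (d <= n)%N).
Hypothesis x_incr : forall i j : 'I_n.+1, (i < j)%N -> x i < x j.

(** [inord] lets the nodes be indexed by [nat], so that products over intervals can be split. *)
Let X (k : nat) : {poly R} := 'X - (x (inord k))%:P.

Let prod_X_neq0 i j : \prod_(i <= k < j) X k ^+ gamma != 0.
Proof.
rewrite prodf_seq_neq0; apply/allP => k _ /=.
by rewrite expf_neq0 // polyXsubC_eq0.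
Qed.

Definition fh_mu (i : nat) : {poly R} :=
  \prod_(0 <= k < i) X k ^+ gamma *
  \prod_((i + d).+1 <= k < n.+1) (- X k) ^+ gamma.

Lemma fh_mu_sum_horner_gt0 (c : R) :
  0 < (\sum_(0 <= i < (n - d).+1) fh_mu i).[c].
Proof.
rewrite horner_sum; under eq_bigr do rewrite hornerM !horner_prod.
pose u k := c - x (inord k).
have u_decr i j : (i < j <= n)%N -> u j < u i.
  move=> /andP[ij jn]; rewrite ltrD2l ltrN2 x_incr // !inordK ?ltnS //.
  exact: ltnW (leq_trans ij jn).
rewrite (eq_bigr (fun i => (\prod_(0 <= k < i) u k ^+ gamma) *
    \prod_((i + d).+1 <= k < n.+1) (- u k) ^+ gamma)); last first.
  by move=> i _; congr (_ * _); apply: eq_bigr => k _;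
    rewrite horner_exp ?hornerN hornerXsubC.
exact: weight_sum_gt0.
Qed.

Let S : {fraction {poly R}} :=
  (-1) ^+ ((n - d) * gamma) * tofrac (\prod_(0 <= k < n.+1) X k ^+ gamma).

(** [S] cancels the poles in the window. Its sign splits into [(-1)^(i gamma)], which cancels that
    of the weight, and [(-1)^((n - d - i) gamma)], which turns [X k] into [- X k] at the [n - d - i]
    nodes after the window. *)
Lemma fh_weight_mu (i : nat) : (i <= n - d)%N ->
  fh_weight x d gamma i * S = tofrac (fh_mu i).
Proof.
move=> le_i; rewrite /fh_weight.
have -> : \prod_(k < n.+1 | (i <= k <= i + d)%N) tofrac ('X - (x k)%:P) ^+ gamma =
    tofrac (\prod_(i <= k < (i + d).+1) X k ^+ gamma).
  rewrite (@big_nat_widenl _ _ _ i 0) // (@big_nat_widen _ _ _ 0 _ n.+1); last by lia.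
  rewrite big_mkord rmorph_prod; apply: eq_big => [k|k _].
    by rewrite ltnS.
  by rewrite /= /X inord_val tofracXn.
set W := \prod_(i <= k < _) _.
have W0 : tofrac W != 0.
  by rewrite tofrac_eq0 prod_X_neq0.
rewrite mulrAC; apply: (canLR (mulfK W0)).
rewrite /S /fh_mu (@big_cat_nat _ _ _ i) //=; last by lia.
rewrite (@big_cat_nat _ _ _ (i + d).+1 i) //=; [|by lia|by lia].
rewrite -/W.
have -> : \prod_((i + d).+1 <= k < n.+1) (- X k) ^+ gamma =
    (-1) ^+ ((n - d - i) * gamma) * \prod_((i + d).+1 <= k < n.+1) X k ^+ gamma.
  under eq_bigr do rewrite exprNn.
  rewrite big_split /= prodr_const_nat -exprM mulnC.
  by congr ((-1) ^+ (_ * _) * _); lia.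
have -> : ((n - d) * gamma = i * gamma + (n - d - i) * gamma)%N.
  by rewrite -mulnDl subnKC.
rewrite exprD !tofracM tofracXn tofracN tofrac1.
have sqr1 : (-1) ^+ (i * gamma) * (-1) ^+ (i * gamma) = 1 :> {fraction {poly R}}.
  by rewrite -exprD addnn -muln2 exprM sqrr_sign.
by rewrite !mulrA sqr1 mul1r; ring.
Qed.

Lemma fh_denominator_mu :
  fh_denominator x d gamma * S = tofrac (\sum_(0 <= i < (n - d).+1) fh_mu i).
Proof.
rewrite /fh_denominator big_mkord mulr_suml rmorph_sum; apply: eq_bigr => i _.
by rewrite fh_weight_mu // -ltnS.
Qed.

(** The common multiplier [S] of numerator and denominator is nonzero and cancels. *)
Lemma fh_rational_quotient (p : 'I_(n - d).+1 -> {poly R}) :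
  fh_rational x gamma p =
  tofrac (\sum_(i < (n - d).+1) fh_mu i * p i) /
  tofrac (\sum_(0 <= i < (n - d).+1) fh_mu i).
Proof.
have S_neq0 : S != 0.
  rewrite mulf_neq0 ?expf_neq0 ?oppr_eq0 ?oner_eq0 //.
  by rewrite tofrac_eq0 prod_X_neq0.
rewrite /fh_rational -fh_denominator_mu rmorph_sum /=.
rewrite [in RHS](eq_bigr (fun i : 'I_(n - d).+1 =>
  fh_weight x d gamma i * tofrac (p i) * S)) => [|i _]; last first.
  have le_i : (i <= n - d)%N by rewrite -ltnS.
  by rewrite [LHS]tofracM -(fh_weight_mu le_i); exact: mulrAC.
rewrite -mulr_suml; move: S_neq0 (\sum_i _) (fh_denominator _ _ _).
by move: S => s s_neq0 num den; rewrite invfM mulrACA divff // mulr1.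
Qed.

End Denominator.

Theorem theorem3p2 (R : realType) (n d gamma : nat) (n_gt0 : (0 < n)%N)
    (gamma_gt0 : (0 < gamma)%N) (le_dn : (d <= n)%N)
    (a b : R) (x : 'I_n.+1 -> R)
    (x_a : x ord0 = a) (x_b : x ord_max = b)
    (x_incr : forall i j : 'I_n.+1, (i < j)%N -> x i < x j)
    (f : R -> R) (p : 'I_(n - d).+1 -> {poly R})
    (p_interp : forall i : 'I_(n - d).+1, interpolates x f d i (p i)) :
  fh_denominator x d gamma != 0 /\
  ~ (exists c : R, pole (fh_rational x gamma p) c).
Proof.
have Q_gt0 := fh_mu_sum_horner_gt0 gamma_gt0 le_dn x_incr.
have Q_neq0 : \sum_(0 <= i < (n - d).+1) fh_mu d gamma x i != 0.
  by apply: contraTneq (Q_gt0 0) => ->; rewrite horner0 ltxx.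
split.
  (* [Q] is the denominator times [S], so it would vanish too. This conjunct keeps the quotient
     [fh_rational] from being a division by zero. *)
  apply: contraNneq Q_neq0 => den0.
  by rewrite -tofrac_eq0 -fh_denominator_mu // den0 mul0r.
case=> c; rewrite fh_rational_quotient // => /(pole_root_denominator Q_neq0).
by rewrite rootE gt_eqF.
Qed.
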